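(* Every compact Hausdorff homogeneous space $X$ admits a transitive continuous action $M \times X \to X$ of a minimal topological group $M$.
   Context: A Hausdorff topological group is minimal if it admits no strictly coarser Hausdorff group topology. A topological space $X$ is homogeneous if for all $x, y \in X$ there is a homeomorphism of $X$ onto itself taking $x$ to $y$. An action is continuous if the map $M \times X \to X$ is jointly continuous. *)

(* Defs.v *)
From HB Require Import structures.
From mathcomp Require Import all_boot all_classical topology.

Set Implicit Arguments.
Unset Strict Implicit.
Unset Printing Implicit Defensive.

Local Open Scope classical_set_scope.
Local Open Scope group_scope.

Definition continuous_group_ops (T : topologicalType)
    (mul : T -> T -> T) (inv : T -> T) : Prop :=
  continuous (fun p : T * T => mul p.1 p.2) /\ continuous inv.

HB.mixin Record Group_isTopologicalGroup G & Group G & Topological G := {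
  group_ops_continuous :
    @continuous_group_ops G (fun x y : G => x * y) (fun x : G => x^-1)
}.

#[short(type="topologicalGroupType")]
HB.structure Definition TopologicalGroup :=
  {G of Group G & Topological G & Group_isTopologicalGroup G}.

(* [s] ranges over all topologies on the carrier of G; [Topological.Pack s] is
   that carrier with the topology [s].  A topology is coarser than another when
   it has fewer open sets. *)
Definition minimal_group (G : topologicalGroupType) : Prop :=
  hausdorff_space G /\
  forall s : Topological.axioms_ G,
    let Gs : topologicalType := Topological.Pack s in
    hausdorff_space Gs ->
    @continuous_group_ops Gs (fun x y : G => x * y) (fun x : G => x^-1) ->
    ~ (@open Gs `<` @open G).

Definition homeomorphism (X Y : topologicalType) (f : X -> Y) : Prop :=
  continuous f /\
  exists g : Y -> X, [/\ cancel f g, cancel g f & continuous g].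

Definition homogeneous (X : topologicalType) : Prop :=
  forall x y : X, exists2 f : X -> X, homeomorphism f & f x = y.

Definition group_action (G : groupType) (X : Type) (act : G -> X -> X) : Prop :=
  (forall x, act 1 x = x) /\
  (forall g h x, act (g * h) x = act g (act h x)).

Definition transitive_action (G : groupType) (X : Type)
    (act : G -> X -> X) : Prop :=
  forall x y, exists g, act g x = y.

(* Main.v *)
(** The topology of the acting group may be taken as fine as we like, so we start
    from the group [G] of all self-homeomorphisms of [X], with the discrete
    topology.  [G] is a quotient of the unrestricted wreath product
    [M = (Z/2)^G : G], with [(Z/2)^G] compact, and [M] is minimal: let [s] be a
    coarser Hausdorff group topology.  Compactness makes [s] agree with the given
    topology on the base [N = (Z/2)^G].  The clopen sets [f 1 = 0] and [f 1 = 1]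
    of [N] are disjoint and compact, hence elements close to [1] for [s] do not
    conjugate any point of the first into the second; but conjugation by
    [(f, g)] with [g <> 1] does so for the indicator function of [g].  Thus [N]
    is open for [s], and [s] is the given topology. *)

Require Import Defs.
From HB Require Import structures.
From mathcomp Require Import all_boot all_classical topology.

Set Implicit Arguments.
Unset Strict Implicit.
Unset Printing Implicit Defensive.

Local Open Scope classical_set_scope.
Local Open Scope group_scope.

(** * The wreath product as a Hausdorff topological group *)

Definition wreath (G : groupType) : Type :=
  ({ptws G -> bool} * discrete_topology G)%type.

HB.instance Definition _ (G : groupType) := Topological.on (wreath G).

Section WreathGroup.
Variable G : groupType.
Implicit Types u v w : wreath G.

Definition wreath_one : wreath G := (fun=> false, 1).

(** Semidirect product law: right translation [f (x * g)] is a left action of [G] on functions, and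
    [(+)] is addition in Z/2. *)
Definition wreath_mul u v : wreath G :=
  (fun x => u.1 x (+) v.1 (x * (u.2 : G)), (u.2 : G) * (v.2 : G)).

Definition wreath_inv u : wreath G :=
  (fun x => u.1 (x * (u.2 : G)^-1), (u.2 : G)^-1).

Lemma wreath_eq u v : u.1 =1 v.1 -> u.2 = v.2 -> u = v.
Proof. by case: u v => [f g] [f' g'] /= /funext -> ->. Qed.

Lemma wreath_mulA : associative wreath_mul.
Proof.
by move=> u v w; apply: wreath_eq => [x|] /=; rewrite ?addbA mulgA.
Qed.

Lemma wreath_mul1 : left_id wreath_one wreath_mul.
Proof. by move=> u; apply: wreath_eq => [x|] /=; rewrite ?mulg1 ?mul1g. Qed.

Lemma wreath_mulr1 : right_id wreath_one wreath_mul.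
Proof. by move=> u; apply: wreath_eq => [x|] /=; rewrite ?addbF ?mulg1. Qed.

Lemma wreath_mulV : left_inverse wreath_one wreath_inv wreath_mul.
Proof. by move=> u; apply: wreath_eq => [x|] /=; rewrite ?addbb ?mulVg. Qed.

Lemma wreath_mulrV : right_inverse wreath_one wreath_inv wreath_mul.
Proof.
by move=> u; apply: wreath_eq => [x|] /=; rewrite ?mulgK ?addbb ?mulgV.
Qed.

HB.instance Definition _ := isGroup.Build (wreath G)
  wreath_mulA wreath_mul1 wreath_mulr1 wreath_mulV wreath_mulrV.

(** The base is abelian, so [u.1] cancels and only the translation by [u.2] survives. *)
Lemma wreath_conj u (h : G -> bool) :
  u * ((h, 1) : wreath G) * u^-1 = (fun x => h (x * (u.2 : G)), 1).
Proof.
apply: wreath_eq => [x|] /=; last by rewrite mulg1 mulgV.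
by rewrite mulg1 mulgK addbAC addbb.
Qed.

(** As [bool] and [G] are discrete, convergence is eventual equality, coordinate by coordinate in
    the base. *)
Lemma wreath_cvgP (T : Type) (F : set_system T) (f : T -> wreath G) u :
  Filter F ->
  f t @[t --> F] --> u <->
  (forall x, \forall t \near F, (f t).1 x = u.1 x) /\
  \forall t \near F, (f t).2 = u.2.
Proof.
move=> FF; split=> [fu|[f1 f2]].
  split=> [x|].
    have : (f t).1 @[t --> F] --> u.1
      by apply: (cvg_comp _ _ fu); exact: cvg_fst.
    move/(@pointwise_cvgP (discrete_topology G) bool) => /(_ x).
    by move/discrete_cvg.
  have : (f t).2 @[t --> F] --> u.2
    by apply: (cvg_comp _ _ fu); exact: cvg_snd.
  by move/discrete_cvg.
have -> : f = fun t => ((f t).1, (f t).2) by apply/funext => t; case: (f t).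
apply: (@cvg_pair _ _ _ F (nbhs u.1) (nbhs u.2)) => /=.
  apply/(@pointwise_cvgP (discrete_topology G) bool) => x.
  by apply/discrete_cvg; exact: f1.
by apply/discrete_cvg.
Qed.

Lemma wreath_near1 u x : \forall v \near u, v.1 x = u.1 x.
Proof.
by have [/(_ x)] := (wreath_cvgP id u (nbhs_filter u)).1 (@cvg_id _ _).
Qed.

Lemma wreath_near2 u : \forall v \near u, v.2 = u.2.
Proof. by have [] := (wreath_cvgP id u (nbhs_filter u)).1 (@cvg_id _ _). Qed.

Lemma wreath_mul_continuous :
  continuous (fun p : wreath G * wreath G => p.1 * p.2).
Proof.
move=> [u v]; apply/wreath_cvgP; split=> [x|].
  near=> p.
  have p1 : p.1.1 x = u.1 x by near: p; exact: cvg_fst (wreath_near1 u x).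
  have p2 : p.1.2 = u.2 by near: p; exact: cvg_fst (wreath_near2 u).
  (* With [p.1.2] frozen at [u.2], a single coordinate of the second factor matters, namely
     [x * u.2]. *)
  rewrite /= p1 p2; congr (_ (+) _).
  by near: p; exact: cvg_snd (wreath_near1 v _).
near=> p => /=; congr (_ * _); near: p.
  exact: cvg_fst (wreath_near2 u).
exact: cvg_snd (wreath_near2 v).
Unshelve. all: by end_near. Qed.

Lemma wreath_inv_continuous : continuous (fun u : wreath G => u^-1).
Proof.
move=> u; apply/wreath_cvgP; split=> [x|].
  near=> v => /=.
  have -> : v.2 = u.2 by near: v; exact: wreath_near2.
  by near: v; exact: wreath_near1.
by near=> v => /=; congr (_^-1); near: v; exact: wreath_near2.
Unshelve. all: by end_near. Qed.

HB.instance Definition _ := Group_isTopologicalGroup.Build (wreath G)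
  (conj wreath_mul_continuous wreath_inv_continuous).

Lemma wreath_hausdorff : hausdorff_space (wreath G).
Proof.
move=> u v uv; apply: wreath_eq => [x|].
  by have [w [/= <- ->]] := uv _ _ (wreath_near1 u x) (wreath_near1 v x).
by have [w [/= <- ->]] := uv _ _ (wreath_near2 u) (wreath_near2 v).
Qed.

Definition base_slice (x : G) (b : bool) : set (wreath G) :=
  [set u | u.1 x = b /\ u.2 = 1].

Lemma base_slice_compact x b : compact (base_slice x b).
Proof.
(* The slice is a product of finite sets, so Tychonoff applies. *)
pose A (i : G) : set bool := if i == x then [set b] else setT.
have -> : base_slice x b =
    (fun f : {ptws G -> bool} => (f, 1) : wreath G) @`
    [set f | forall i, A i (f i)].
  apply/seteqP; split=> [[f g] [/= fx ->]|_ [f fA <-]].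
    by exists f => // i; rewrite /A; case: eqP => [->|].
  by split=> //; have := fA x; rewrite /A eqxx.
apply: (@continuous_compact {ptws G -> bool} (wreath G)); last first.
  by apply: tychonoff => i; apply: finite_compact; exact: finite_finset.
apply: continuous_subspaceT => f.
apply: (@cvg_pair _ _ _ (nbhs f) (nbhs f) (nbhs _)); first exact: cvg_id.
exact: cvg_cst.
Qed.

End WreathGroup.

(** * Coarser Hausdorff group topologies on the wreath product *)

Section CoarserTopology.
Variables (G : groupType) (s : Topological.axioms_ (wreath G)).
Let M : topologicalType := Topological.Pack s.
Hypothesis hausM : hausdorff_space M.
Hypothesis opsM :
  @continuous_group_ops M (fun x y : wreath G => x * y)
    (fun x : wreath G => x^-1).
Hypothesis coarseM : @open M `<=` @open (wreath G).

(** The identity from a finer to a coarser topology is continuous, and continuous images of compact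
    sets are compact. *)
Lemma coarser_slice_compact x b : compact (base_slice x b : set M).
Proof.
have -> : base_slice x b = (fun u : wreath G => u : M) @` base_slice x b.
  by rewrite image_id.
apply: continuous_compact; last exact: base_slice_compact.
by apply: continuous_subspaceT; apply/continuousP => A /coarseM.
Qed.

Lemma coarser_slice_closed x b : closed (base_slice x b : set M).
Proof. by apply: compact_closed => //; exact: coarser_slice_compact. Qed.

(** The group operations are retyped on [M] so that limits are taken for [s]. *)
Let mulM (u v : M) : M := (u : wreath G) * (v : wreath G).
Let invM (u : M) : M := (u : wreath G)^-1.
Let oneM : M := 1 : wreath G.

Lemma coarser_mul_cvg (T : Type) (F : set_system T) (f g : T -> M) (u v : M) :
  Filter F -> f t @[t --> F] --> u -> g t @[t --> F] --> v ->
  mulM (f t) (g t) @[t --> F] --> mulM u v.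
Proof.
move=> FF fu gv; apply: (cvg_comp2 fu gv); exact: (opsM.1 (u, v)).
Qed.

Lemma coarser_near_base : \forall u \near oneM, (u : wreath G).2 = 1.
Proof.
have tube : \forall u \near oneM, base_slice 1 false `<=`
    [set h | ~ base_slice 1 true (mulM (mulM u h) (invM u))].
  (* Tube lemma: compactness turns a neighbourhood of [1] for each [h] into one that serves the
     whole slice. *)
  apply: ((compact_near_coveringP _).1 (@coarser_slice_compact 1 false)).
  move=> h [h0 _].
  have conj_cvg : mulM (mulM p.2 p.1) (invM p.2) @[p --> (h, oneM)] --> h.
    have {2}-> : h = mulM (mulM oneM h) (invM oneM).
      by rewrite /mulM /invM /oneM invg1 mulg1 mul1g.
    apply: coarser_mul_cvg; last first.
      by apply: (cvg_comp _ _ cvg_snd); exact: opsM.2.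
    by apply: coarser_mul_cvg; [exact: cvg_snd|exact: cvg_fst].
  apply: (conj_cvg (~` base_slice 1 true)); apply: open_nbhs_nbhs; split.
    by apply: closed_openC; exact: coarser_slice_closed.
  by move=> []; rewrite h0.
apply: filterS tube => u; set r : wreath G := u => sub.
apply: contrapT => /eqP r2.
(* This indicator vanishes at [1] since [r.2] differs from [1]; its conjugate takes at [1] the value
   it has at [r.2]. *)
apply: (sub ((fun x => x == (r.2 : G)), 1)).
  by split=> //=; apply/negbTE; rewrite eq_sym.
by rewrite /mulM /invM -/r wreath_conj; split=> //=; rewrite mul1g eqxx.
Qed.

Lemma coarser_near_coordinate x :
  \forall u \near oneM, (u : wreath G).1 x = false.
Proof.
have : nbhs oneM (~` base_slice x true).
  apply: open_nbhs_nbhs; split; last by case.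
  by apply: closed_openC; exact: coarser_slice_closed.
apply: filterS2 coarser_near_base => u u2.
by case: (boolP (u.1 x)) => // ux; case.
Qed.

Lemma coarser_id_continuous : continuous (fun u : M => u : wreath G).
Proof.
move=> u; pose r : wreath G := u.
have cvg1 : mulM (invM u) v @[v --> u] --> oneM.
  have -> : oneM = mulM (invM u) u by rewrite /mulM /invM mulVg.
  by apply: coarser_mul_cvg; [exact: cvg_cst|exact: cvg_id].
apply/wreath_cvgP; split=> [x|].
  (* The coordinate [x * r.2] of [u^-1 * v] is [u.1 x (+) v.1 x], so its vanishing gives
     [v.1 x = u.1 x]. *)
  have near_x := cvg1 _ (coarser_near_coordinate (x * (r.2 : G))).
  apply: (@filterS M (nbhs u) _ _ _ _ near_x) => v /=.
  by rewrite !mulgK -/r; case: (r.1 x) (v.1 x) => [] [].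
apply: (@filterS M (nbhs u) _ _ _ _ (cvg1 _ coarser_near_base)) => v /=.
by move=> /(canRL (mulKg _)); rewrite invgK mulg1.
Qed.

Lemma open_coarser : @open (wreath G) `<=` @open M.
Proof. by move=> A; move/continuousP: coarser_id_continuous => /[apply]. Qed.

End CoarserTopology.

Lemma wreath_minimal (G : groupType) : minimal_group (wreath G).
Proof.
split=> [|s Gs hausGs opsGs [sub]]; first exact: wreath_hausdorff.
by apply; exact: open_coarser.
Qed.

(** * The group of self-homeomorphisms and its action *)

Section HomeomorphismGroup.
Variable X : topologicalType.

Record homeo := Homeo {
  homeo_fun :> X -> X;
  homeo_inv : X -> X;
  homeo_funK : cancel homeo_fun homeo_inv;
  homeo_invK : cancel homeo_inv homeo_fun;
  homeo_continuous : continuous homeo_fun;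
  homeo_inv_continuous : continuous homeo_inv
}.

HB.instance Definition _ := gen_eqMixin homeo.
HB.instance Definition _ := gen_choiceMixin homeo.

(** The map determines its inverse; the remaining fields are proofs. *)
Lemma homeo_eq (g h : homeo) : g =1 h -> g = h.
Proof.
move=> gh; have gh' : homeo_inv g =1 homeo_inv h.
  by move=> x; rewrite -{1}(homeo_invK h x) -gh homeo_funK.
case: g h gh gh' => [g g' ? ? ? ?] [h h' ? ? ? ?] /= /funext E /funext E'.
by subst h h'; congr Homeo; exact: Prop_irrelevance.
Qed.

Definition homeo_id : homeo := @Homeo id id (fun=> erefl) (fun=> erefl)
  (fun=> @cvg_id _ _) (fun=> @cvg_id _ _).

Definition homeo_comp (g h : homeo) : homeo :=
  @Homeo (g \o h) (homeo_inv h \o homeo_inv g)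
    (can_comp (homeo_funK g) (homeo_funK h))
    (can_comp (homeo_invK h) (homeo_invK g))
    (fun x => continuous_comp (@homeo_continuous h x) (@homeo_continuous g _))
    (fun x => continuous_comp (@homeo_inv_continuous g x)
                (@homeo_inv_continuous h _)).

Definition homeo_sym (g : homeo) : homeo :=
  Homeo (homeo_invK g) (homeo_funK g) (@homeo_inv_continuous g)
    (@homeo_continuous g).

Lemma homeo_compA : associative homeo_comp.
Proof. by move=> g h k; apply: homeo_eq. Qed.

Lemma homeo_comp1 : left_id homeo_id homeo_comp.
Proof. by move=> g; apply: homeo_eq. Qed.

Lemma homeo_compr1 : right_id homeo_id homeo_comp.
Proof. by move=> g; apply: homeo_eq. Qed.

Lemma homeo_compV : left_inverse homeo_id homeo_sym homeo_comp.
Proof. by move=> g; apply: homeo_eq => x /=; rewrite homeo_funK. Qed.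

Lemma homeo_comprV : right_inverse homeo_id homeo_sym homeo_comp.
Proof. by move=> g; apply: homeo_eq => x /=; rewrite homeo_invK. Qed.

HB.instance Definition _ := isGroup.Build homeo
  homeo_compA homeo_comp1 homeo_compr1 homeo_compV homeo_comprV.

End HomeomorphismGroup.

Theorem corollary7p3 (X : topologicalType)
    (cX : compact [set: X]) (hX : hausdorff_space X) (homX : homogeneous X) :
  exists (M : topologicalGroupType) (act : M -> X -> X),
    [/\ minimal_group M,
        group_action act,
        continuous (fun p : M * X => act p.1 p.2) &
        transitive_action act].
Proof.
exists (wreath (homeo X)), (fun u => (u.2 : homeo X)); split.
- exact: wreath_minimal.
- by split.
- move=> [u x] A /= uxA.
  (* The acting homeomorphism is locally constant in [u], so joint continuity reduces to the
     continuity of [u.2]. *)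
  have [near_u near_x] : nbhs u [set v : wreath (homeo X) | v.2 = u.2] /\
      nbhs x ((u.2 : homeo X) @^-1` A).
    by split; [exact: wreath_near2|exact: homeo_continuous].
  by exists ([set v | v.2 = u.2], (u.2 : homeo X) @^-1` A) => // -[v y] /= [->].
- move=> x y; have [f [fC [g [fK gK gC]]] fxy] := homX x y.
  by exists ((fun=> false, Homeo fK gK fC gC) : wreath (homeo X)).
Qed.
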